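(* Let $N$ and $D$ be positive integers with $D$ dividing $N$. Consider the tiled matrix multiplication of two $N\times N$ matrices $A,B$ into $C$, executed as the loop nest for jj = 0, D, 2D, ..., N−D: for kk = 0, D, ..., N−D: for i = 0..N−1: for j = jj..jj+D−1: for k = kk..kk+D−1: C[i][j] = C[i][j] + A[i][k]*B[k][j]. Its Data Movement Distance $\mathrm{DMD}_{TMM}$ satisfies $$\frac{N^4}{D} + N^3 D \;<\; \sim(\mathrm{DMD}_{TMM}) \;<\; 2\sqrt{3}\,\frac{N^4}{D} + \sqrt{2}\,N^3 D .$$
   Context: The execution is viewed as a trace of accesses to the individual matrix elements, and each element of $A$, $B$, $C$ is one memory location. The reuse distance of an access is the number of distinct locations accessed between the previous access to the same location and the current access, counting the location itself. The Data Movement Distance is $\mathrm{DMD}=\sum_i\sqrt{d_i}$, summed over all accesses that have a reuse distance $d_i$ (that is, all non-first accesses to a location); this is the access cost in an infinite LRU hierarchy where the datum at stack position $k$ costs $\sqrt{k}$. The notation $\sim(\cdot)$ denotes asymptotic equivalence as $N\to\infty$, like big-O but keeping the coefficients of the leading terms; the inequalities compare these leading-order expressions. *)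

(* Defs.v *)
From HB Require Import structures.
From mathcomp Require Import all_boot all_order all_algebra.
From mathcomp Require Import all_classical all_reals all_analysis.

Set Implicit Arguments.
Unset Strict Implicit.
Unset Printing Implicit Defensive.

Import Order.TTheory GRing.Theory Num.Theory.
Import numFieldNormedType.Exports.

Local Open Scope classical_set_scope.
Local Open Scope ring_scope.

(* [rev (take t s)] lists the accesses before time t, most recent first, so
   [index x] finds the previous access to x; that access is counted, and it
   accounts for the location x itself. *)
Definition reuse_distance (T : eqType) (s : seq T) (t : nat) (x : T) : nat :=
  let past := rev (take t s) in
  size (undup (take (index x past).+1 past)).

Definition DMD (R : realType) (T : eqType) (s : seq T) : R :=
  \sum_(t < size s | tnth (in_tuple s) t \in take t s)
    Num.sqrt (reuse_distance s t (tnth (in_tuple s) t))%:R.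

Definition location : Type := (nat * nat + nat * nat + nat * nat)%type.

Definition elA (i j : nat) : location := inl (inl (i, j)).
Definition elB (i j : nat) : location := inl (inr (i, j)).
Definition elC (i j : nat) : location := inr (i, j).

(* C[i][j] = C[i][j] + A[i][k]*B[k][j]: the operands are read from left to
   right, then C[i][j] is written. *)
Definition body_trace (i j k : nat) : seq location :=
  [:: elC i j; elA i k; elB k j; elC i j].

Definition tmm_trace (N D : nat) : seq location :=
  \big[cat/[::]]_(0 <= jj < N | (D %| jj)%N)
  \big[cat/[::]]_(0 <= kk < N | (D %| kk)%N)
  \big[cat/[::]]_(0 <= i < N)
  \big[cat/[::]]_(jj <= j < jj + D)
  \big[cat/[::]]_(kk <= k < kk + D)
    body_trace i j k.

Definition DMD_TMM (R : realType) (N D : nat) : R := DMD R (tmm_trace N D).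

(* The regime N --> oo over pairs (N, D) with D dividing N, uniformly in D:
   D may stay bounded or grow with N. *)
Definition tmm_regime : set_system (nat * nat) :=
  within [set p | (0 < p.1)%N /\ (0 < p.2)%N /\ (p.2 %| p.1)%N]
    (filter_prod \oo (globally [set: nat])).

Global Instance tmm_regime_filter : Filter tmm_regime.
Proof. exact: within_filter. Qed.

Canonical tmm_regime_filterType := FilterType tmm_regime tmm_regime_filter.

(* [~_] from landau is stated for functions into a normed module, here R^o. *)
Definition tmm_equiv (R : realType) (f g : nat -> nat -> R) : Prop :=
  (fun p : nat * nat => f p.1 p.2 : R^o) ~_tmm_regime
  (fun p : nat * nat => g p.1 p.2 : R^o).

Definition tmm_lower (R : realType) (N D : nat) : R :=
  N%:R ^+ 4 / D%:R + N%:R ^+ 3 * D%:R.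

Definition tmm_upper (R : realType) (N D : nat) : R :=
  2 * Num.sqrt 3 * (N%:R ^+ 4 / D%:R) + Num.sqrt 2 * (N%:R ^+ 3 * D%:R).

(* Main.v *)
Require Import Defs.
From HB Require Import structures.
From mathcomp Require Import all_boot all_order all_algebra.
From mathcomp Require Import all_classical all_reals all_analysis.
From mathcomp Require Import zify ring lra.

Set Implicit Arguments.
Unset Strict Implicit.
Unset Printing Implicit Defensive.

Import Order.TTheory GRing.Theory Num.Theory.
Import numFieldNormedType.Exports.

Local Open Scope classical_set_scope.
Local Open Scope ring_scope.

(* An iteration of the innermost loop is a triple (i, j, k), and the loop nest
   runs through all triples in the lexicographic order of
   (j / D, k / D, i, j, k).  The reuse window of an access is therefore the set
   of triples between two given ones in that order, and counting the locations
   it touches gives, with q = N / D and up to lower-order terms: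
   - A[i][k] at the first column j of a tile (N^3 / D accesses): the whole of A
     has been read since, and O(ND) other elements, whence the cost N + O(D);
   - B[k][j] with i > 0 (about N^3 accesses): the current tile of B and O(D)
     other elements, whence the cost D + O(1);
   - every other access of A or C costs O(sqrt D), or O(sqrt (ND)) for the
     N^3 / D reads of C at the first k of a tile;
   - the O(N^2) accesses at i = 0, j = 0 or k = 0 cost at most 2N, since there
     are only 3N^2 locations.
   Hence DMD = N^3 (q + D + O(1 + sqrt q + sqrt D)), and the error is negligible
   uniformly in D because q D = N forces q + D to be large.  The lower bound
   holds for DMD itself thanks to the N^3 writes of C, each of cost
   at least sqrt 3. *)

(** * Cost of accesses relative to a given past *)

Definition cost (R : realType) (T : eqType) (p : seq T) (x : T) : R :=
  if x \in p then Num.sqrt (reuse_distance p (size p) x)%:R else 0.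

(** Carrying the past as an argument lets a trace be cut at any point; since [cost] is 0 at a first
    access, the side condition in [DMD] disappears. *)
Fixpoint DMD_after (R : realType) (T : eqType) (p s : seq T) : R :=
  if s is x :: s' then cost R p x + DMD_after R (rcons p x) s' else 0.

Lemma DMD_after_sum (R : realType) (T : eqType) (p s : seq T) :
  DMD_after R p s =
  \sum_(t < size s) cost R (p ++ take t s) (tnth (in_tuple s) t).
Proof.
elim: s p => [|x s IHs] p; first by rewrite big_ord0.
rewrite /= big_ord_recl /= cats0 (tnth_nth x) /= IHs; congr (_ + _).
apply: eq_bigr => t _; rewrite -cat_rcons; congr (cost R _ _).
by rewrite !(tnth_nth x).
Qed.

Lemma DMD_after_nil (R : realType) (T : eqType) (s : seq T) :
  DMD R s = DMD_after R [::] s.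
Proof.
rewrite DMD_after_sum /DMD big_mkcond /=; apply: eq_bigr => t _.
rewrite /cost; case: ifP => // _; congr (Num.sqrt (_%:R)).
by rewrite /reuse_distance take_size.
Qed.

Lemma DMD_after_cat (R : realType) (T : eqType) (p s1 s2 : seq T) :
  DMD_after R p (s1 ++ s2) = DMD_after R p s1 + DMD_after R (p ++ s1) s2.
Proof.
elim: s1 p => [|x s1 IHs] p /=; first by rewrite cats0 add0r.
by rewrite IHs addrA cat_rcons.
Qed.

(** If [x] occurs at all, its last access lies in [q], so the reuse window is contained in [q] and
    its distinct locations are among those of [c]. *)
Lemma cost_le (R : realType) (T : eqType) (p q c : seq T) (x : T) :
  (x \in p ++ q -> x \in q) -> {subset q <= c} ->
  cost R (p ++ q) x <= Num.sqrt (size c)%:R.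
Proof.
move=> xq qc; rewrite /cost; case: ifP => [/xq {}xq|_]; last exact: sqrtr_ge0.
rewrite ler_sqrt ?ler0n // ler_nat /reuse_distance take_size rev_cat index_cat.
rewrite mem_rev xq takel_cat; last by rewrite index_mem mem_rev.
apply: uniq_leq_size; first exact: undup_uniq.
by move=> y; rewrite mem_undup => /mem_take; rewrite mem_rev => /qc.
Qed.

(** As [x] is absent from [m], the reuse window extends over all of [m] back into [p], and contains
    [x] besides the distinct elements of [u]. *)
Lemma cost_ge (R : realType) (T : eqType) (p m u : seq T) (x : T) :
  x \in p -> x \notin m -> uniq u -> {subset u <= m} ->
  Num.sqrt (size u).+1%:R <= cost R (p ++ m) x.
Proof.
move=> xp xm uu um; rewrite /cost mem_cat xp /= ler_sqrt ?ler0n // ler_nat.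
have xu : x \notin u by apply: contra xm => /um.
rewrite (_ : (size u).+1 = size (x :: u)) //.
apply: uniq_leq_size; first by rewrite /= xu.
rewrite /reuse_distance take_size rev_cat index_cat mem_rev (negbTE xm).
move=> y; rewrite inE mem_undup take_cat ltnNge leqW ?leq_addr //= mem_cat mem_rev.
case/orP=> [/eqP ->|/um ->//]; apply/orP; right.
(* The oldest entry of the window is the previous access to [x] itself, which the [.+1] in
   [reuse_distance] includes. *)
rewrite subSn ?leq_addr // addKn -[X in X \in _](nth_index x (s := rev p)); last by rewrite mem_rev.
have lt_i : (index x (rev p) < size (rev p))%N by rewrite index_mem mem_rev.
by rewrite (take_nth x lt_i) mem_rcons mem_head.
Qed.

(** * Traces of iterations listed in a strict order *)

Section Ordered_iterations.
Variables (I T : eqType) (lt : rel I) (b : I -> seq T).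
Hypotheses (ltxx : irreflexive lt) (lt_trans : transitive lt).

Definition accesses (L : seq I) : seq T := flatten (map b L).

Lemma filter_lt_cat (L1 L2 : seq I) (e : I) : pairwise lt (L1 ++ e :: L2) ->
  [seq f <- L1 ++ e :: L2 | lt f e] = L1.
Proof.
rewrite pairwise_cat allrel_consr /= => /and3P[/andP[L1e _] _ /andP[eL2 _]].
rewrite filter_cat (all_filterP L1e) /= ltxx -[RHS]cats0; congr (_ ++ _).
apply/eqP; rewrite -[_ == _]negbK -has_filter; apply/hasPn => f /(allP eL2) ef.
by apply/negP => /(lt_trans ef); rewrite ltxx.
Qed.

(** In a sorted list the prefix before [e] is the set of elements below [e]. Each summand thus
    depends on [e] alone, and the sum may be reordered. *)
Lemma DMD_after_accesses (R : realType) (L1 L2 : seq I) : pairwise lt (L1 ++ L2) ->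
  DMD_after R (accesses L1) (accesses L2) =
  \sum_(e <- L2) DMD_after R (accesses [seq f <- L1 ++ L2 | lt f e]) (b e).
Proof.
elim: L2 L1 => [|e L2 IHL] L1 ltL; first by rewrite big_nil.
rewrite big_cons [accesses (e :: L2)]/= DMD_after_cat filter_lt_cat //.
congr (_ + _); rewrite -cat_rcons -IHL ?cat_rcons //.
by rewrite /accesses map_rcons flatten_rcons.
Qed.

(** Cuts the past of [e] at an earlier [e0]; the last piece becomes the reuse window of a location
    last used in [e0]. *)
Lemma filter_lt_window (L : seq I) (e0 e : I) : pairwise lt L -> e0 \in L ->
  lt e0 e -> [seq f <- L | lt f e] =
  [seq f <- L | lt f e0] ++ e0 :: [seq f <- L | lt e0 f && lt f e].
Proof.
move=> + e0L; case/splitPr: e0L => L1 L2 ltL e0e.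
rewrite (filter_lt_cat ltL); move: ltL.
rewrite pairwise_cat allrel_consr /= => /and3P[/andP[L1e _] _ /andP[eL2 _]].
rewrite !filter_cat /= e0e ltxx /=.
have -> : [seq f <- L1 | lt f e] = L1.
  by apply/all_filterP/allP => f /(allP L1e) /lt_trans; apply.
have -> : [seq f <- L1 | lt e0 f && lt f e] = [::].
  apply/eqP; rewrite -[_ == _]negbK -has_filter; apply/hasPn => f /(allP L1e) fe.
  by apply/negP => /andP[/(lt_trans fe)]; rewrite ltxx.
congr (_ ++ _ :: _) => /=.
by apply/eq_in_filter => f /(allP eL2) ->.
Qed.

End Ordered_iterations.

(** * Loops as concatenations, and numerical square roots *)

Lemma mem_bigcat_nat (T : eqType) (m n : nat) (P : pred nat) (F : nat -> seq T) (x : T) :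
  reflect (exists i, [/\ (m <= i < n)%N, P i & x \in F i])
          (x \in \big[cat/[::]]_(m <= i < n | P i) F i).
Proof.
rewrite -big_filter; set r := [seq _ <- _ | _].
have -> : (x \in \big[cat/[::]]_(i <- r) F i) = has (fun i => x \in F i) r.
  by elim: r => [|i r IHr]; rewrite ?big_nil // big_cons mem_cat IHr.
apply: (iffP hasP) => [[i]|[i [imn Pi xi]]]; last first.
  by exists i => //; rewrite mem_filter Pi mem_index_iota.
by rewrite mem_filter mem_index_iota => /andP[]; exists i.
Qed.

Lemma pairwise_bigcat_nat (T : eqType) (lt : rel T) (m n : nat) (P : pred nat)
    (F : nat -> seq T) :
  (forall i, (m <= i < n)%N -> P i -> pairwise lt (F i)) ->
  (forall i j x y, (m <= i < n)%N -> (m <= j < n)%N -> P i -> P j -> (i < j)%N ->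
     x \in F i -> y \in F j -> lt x y) ->
  pairwise lt (\big[cat/[::]]_(m <= i < n | P i) F i).
Proof.
elim: n => [|n IHn] ltF ltFF; first by rewrite big_geq.
have [mn|nm] := leqP m n; last by rewrite big_geq.
rewrite big_mkcond big_nat_recr //= -big_mkcond /= pairwise_cat.
have sub i : (m <= i < n)%N -> (m <= i < n.+1)%N.
  by case/andP=> -> /ltnW.
rewrite IHn; first last.
- by move=> i j x y /sub ? /sub ?; apply: ltFF.
- by move=> i /sub; apply: ltF.
case: ifP => [Pn|_]; last by rewrite allrel0r.
rewrite ltF ?mn ?ltnS ?leqnn // andbT andbT; apply/allrelP => x y.
move/mem_bigcat_nat => [i [imn Pi xi]] yn.
apply: (ltFF i n) => //; first exact: sub.
  by rewrite mn ltnSn.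
by case/andP: imn.
Qed.

Lemma sqrt_nat_le (R : realType) (m n : nat) : (m <= n ^ 2)%N ->
  Num.sqrt m%:R <= n%:R :> R.
Proof.
move=> mn; apply: le_trans (_ : Num.sqrt (n%:R ^+ 2) <= _); last first.
  by rewrite sqrtr_sqr normr_nat.
by rewrite ler_sqrt ?sqr_ge0 // -natrX ler_nat.
Qed.

(** This precision suffices for both uses: 3 < 2 * 17/10 in the lower bound, and 7/5 + 1 <= 2 *
    17/10 in the comparison with [tmm_upper]. *)
Lemma sqrt3_ge (R : realType) : 17 / 10 <= Num.sqrt 3 :> R.
Proof.
rewrite -[17 / 10]ger0_norm -?sqrtr_sqr; last by lra.
by rewrite ler_sqrt; lra.
Qed.

(** * Iterations and their lexicographic order *)

Definition iteration : Type := (nat * nat * nat)%type.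

Definition iterations (N D : nat) : seq iteration :=
  \big[cat/[::]]_(0 <= jj < N | (D %| jj)%N)
  \big[cat/[::]]_(0 <= kk < N | (D %| kk)%N)
  \big[cat/[::]]_(0 <= i < N)
  \big[cat/[::]]_(jj <= j < jj + D)
  \big[cat/[::]]_(kk <= k < kk + D) [:: (i, j, k)].

Definition body (e : iteration) : seq location := body_trace e.1.1 e.1.2 e.2.

Lemma tmm_trace_accesses (N D : nat) :
  tmm_trace N D = accesses body (iterations N D).
Proof.
(* [accesses body] is a morphism for concatenation, so it passes through the five loops one after
   the other. *)
have accU := @big_morph _ _ (accesses body) [::] cat [::] cat
  (fun s1 s2 => etrans (congr1 flatten (map_cat body s1 s2)) (flatten_cat _ _)) erefl.
rewrite /iterations accU; apply: eq_bigr => jj _.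
rewrite accU; apply: eq_bigr => kk _.
rewrite accU; apply: eq_bigr => i _.
rewrite accU; apply: eq_bigr => j _.
by rewrite accU.
Qed.

(** One level of a lexicographic comparison: [c] is the outcome on the remaining coordinates, so
    nesting gives the whole order. *)
Definition lexn (x y : nat) (c : bool) : bool := (x < y)%N || (x == y) && c.

Lemma lexnP (x y : nat) (c : bool) :
  reflect ((x <= y)%N /\ (x = y -> c)) (lexn x y c).
Proof.
rewrite /lexn; apply: (iffP orP) => [[xy|/andP[/eqP-> //]]|[xy xyc]].
  by split; [exact: ltnW | move=> xyE; rewrite xyE ltnn in xy].
by case: (ltngtP x y) xy => // [xy _|xyE _]; [left | right; rewrite xyc].
Qed.

Lemma negb_lexn (x y : nat) (c : bool) : ~~ lexn x y c = lexn y x (~~ c).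
Proof. by rewrite /lexn; case: ltngtP => //=; case: c. Qed.

Lemma lexn_trans (x y z : nat) (c1 c2 c3 : bool) : (c1 -> c2 -> c3) ->
  lexn x y c1 -> lexn y z c2 -> lexn x z c3.
Proof.
move=> c13 /lexnP[xy c1P] /lexnP[yz c2P]; apply/lexnP; split.
  exact: leq_trans xy yz.
move=> xz; have xyE : x = y by apply/eqP; rewrite eqn_leq xy xz.
by apply: c13; [exact: c1P | apply: c2P; rewrite -xyE].
Qed.

Lemma lexn_le (x y : nat) (c : bool) : lexn x y c -> (x <= y)%N.
Proof. by case/lexnP. Qed.

Lemma lexn_lt (x y : nat) (c : bool) : (x < y)%N -> lexn x y c.
Proof. by rewrite /lexn => ->. Qed.

Lemma lexnn (x : nat) (c : bool) : lexn x x c = c.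
Proof. by rewrite /lexn ltnn eqxx. Qed.

Lemma lexn_false (x y : nat) : lexn x y false = (x < y)%N.
Proof. by rewrite /lexn andbF orbF. Qed.

(** Used for an iteration lying between two others that agree in a coordinate: it shares that
    coordinate, and the comparisons pass to the remaining ones. *)
Lemma lexn_squeeze (x y : nat) (c c' : bool) :
  lexn x y c -> lexn y x c' -> [/\ y = x, c & c'].
Proof.
move=> xy yx; have yxE : y = x by apply/eqP; rewrite eqn_leq (lexn_le xy) (lexn_le yx).
by move: xy yx; rewrite yxE !lexnn.
Qed.

(* The loop indices are recovered as [jj = D * (j %/ D)], [kk = D * (k %/ D)]. *)
Definition before (D : nat) (e f : iteration) : bool :=
  lexn (e.1.2 %/ D) (f.1.2 %/ D) (lexn (e.2 %/ D) (f.2 %/ D)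
    (lexn e.1.1 f.1.1 (lexn e.1.2 f.1.2 (e.2 < f.2)%N))).

Lemma before_irr (D : nat) : irreflexive (before D).
Proof. by move=> e; rewrite /before /lexn !ltnn !eqxx. Qed.

Lemma before_trans (D : nat) : transitive (before D).
Proof. by move=> f e g; do 4!apply: lexn_trans; apply: ltn_trans. Qed.

Lemma before_total (D : nat) (e f : iteration) : e != f -> before D e f || before D f e.
Proof.
case: e f => -[i j] k [[i' j'] k'] ne; rewrite /before /lexn /=.
case: (ltngtP (j %/ D) (j' %/ D)) => //= _.
case: (ltngtP (k %/ D) (k' %/ D)) => //= _.
case: (ltngtP i i') ne => //= ->; case: (ltngtP j j') => //= ->.
by case: (ltngtP k k') => //= ->; rewrite eqxx.
Qed.

(** * The execution order of the tiled loop nest *)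

Section Tiled.
Variables N D : nat.
Hypotheses (D_gt0 : (0 < D)%N) (dvdDN : (D %| N)%N).

Lemma divn_tile (a x : nat) : (D %| a)%N -> (a <= x < a + D)%N -> (x %/ D = a %/ D)%N.
Proof.
case/dvdnP=> q -> /andP[qx xq]; rewrite mulnK //.
by apply/eqP; rewrite eqn_leq -ltnS ltn_divLR // leq_divRL // mulSn addnC xq qx.
Qed.

Lemma ltn_divn (a c : nat) : (D %| a)%N -> (D %| c)%N -> (a < c)%N -> (a %/ D < c %/ D)%N.
Proof. by move=> Da Dc ac; rewrite ltn_divRL // divnK. Qed.

(** At each loop level the outer indices, or the tiles that they determine, agree, so the first
    differing loop index decides the comparison. *)
Lemma pairwise_before : pairwise (before D) (iterations N D).
Proof.
apply: pairwise_bigcat_nat => [jj _ Djj|jj jj' x y _ _ Djj Djj' jjlt].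
  apply: pairwise_bigcat_nat => [kk _ Dkk|kk kk' x y _ _ Dkk Dkk' kklt].
    apply: pairwise_bigcat_nat => [i _ _|i i' x y _ _ _ _ ilt].
      apply: pairwise_bigcat_nat => [j /(divn_tile Djj) jE _|j j' x y].
        apply: pairwise_bigcat_nat => [//|k k' x y /(divn_tile Dkk) kE].
        move=> /(divn_tile Dkk) kE' _ _ klt; rewrite !inE => /eqP-> /eqP->.
        by rewrite /before /lexn /= kE kE'; lia.
      move=> /(divn_tile Djj) jE /(divn_tile Djj) jE' _ _ jlt.
      move=> /mem_bigcat_nat[k [/(divn_tile Dkk) kE _]]; rewrite inE => /eqP->.
      move=> /mem_bigcat_nat[k' [/(divn_tile Dkk) kE' _]]; rewrite inE => /eqP->.
      by rewrite /before /lexn /= kE kE' jE jE'; lia.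
    move=> /mem_bigcat_nat[j [/(divn_tile Djj) jE _]].
    move=> /mem_bigcat_nat[k [/(divn_tile Dkk) kE _]]; rewrite inE => /eqP->.
    move=> /mem_bigcat_nat[j' [/(divn_tile Djj) jE' _]].
    move=> /mem_bigcat_nat[k' [/(divn_tile Dkk) kE' _]]; rewrite inE => /eqP->.
    by rewrite /before /lexn /= kE kE' jE jE'; lia.
  move=> /mem_bigcat_nat[i [_ _]] /mem_bigcat_nat[j [/(divn_tile Djj) jE _]].
  move=> /mem_bigcat_nat[k [/(divn_tile Dkk) kE _]]; rewrite inE => /eqP->.
  move=> /mem_bigcat_nat[i' [_ _]] /mem_bigcat_nat[j' [/(divn_tile Djj) jE' _]].
  move=> /mem_bigcat_nat[k' [/(divn_tile Dkk') kE' _]]; rewrite inE => /eqP->.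
  have := ltn_divn Dkk Dkk' kklt.
  by rewrite /before /lexn /= kE kE' jE jE'; lia.
move=> /mem_bigcat_nat[kk [_ _]].
move=> /mem_bigcat_nat[i [_ _]] /mem_bigcat_nat[j [/(divn_tile Djj) jE _]].
move=> /mem_bigcat_nat[k [_ _]]; rewrite inE => /eqP->.
move=> /mem_bigcat_nat[kk' [_ _]].
move=> /mem_bigcat_nat[i' [_ _]] /mem_bigcat_nat[j' [/(divn_tile Djj') jE' _]].
move=> /mem_bigcat_nat[k' [_ _]]; rewrite inE => /eqP->.
have := ltn_divn Djj Djj' jjlt.
by rewrite /before /lexn /= jE jE'; lia.
Qed.

(** Divisibility of [N] by [D] keeps the last tile inside the matrix. *)
Lemma tile_bound (a x : nat) : (D %| a)%N -> (a < N)%N -> (x < a + D)%N -> (x < N)%N.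
Proof.
move=> Da aN xa; apply: leq_trans xa _.
case/dvdnP: Da aN => q ->; case/dvdnP: dvdDN => n ->.
by rewrite ltn_mul2r -mulSnr leq_mul2r => /andP[_ ->]; rewrite orbT.
Qed.

Lemma mem_iterations (i j k : nat) :
  ((i, j, k) \in iterations N D) = [&& i < N, j < N & k < N]%N.
Proof.
apply/mem_bigcat_nat/and3P => [[jj [jjN Djj]]|[iN jN kN]].
  move=> /mem_bigcat_nat[kk [kkN Dkk]] /mem_bigcat_nat[i' [i'N _]].
  move=> /mem_bigcat_nat[j' [j'N _]] /mem_bigcat_nat[k' [k'N _]].
  rewrite inE => /eqP[-> -> ->]; split => //.
    by apply: (tile_bound Djj) => //; case/andP: j'N.
  by apply: (tile_bound Dkk) => //; case/andP: k'N.
have tileP x : (x < N)%N -> [/\ (0 <= x %/ D * D < N)%N, (D %| x %/ D * D)%N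
    & (x %/ D * D <= x < x %/ D * D + D)%N].
  move=> xN; rewrite dvdn_mull // leq_trunc_div (leq_ltn_trans (leq_trunc_div x D)) //.
  by rewrite -mulSnr ltn_ceil.
have [jj1 jj2 jj3] := tileP _ jN; have [kk1 kk2 kk3] := tileP _ kN.
exists (j %/ D * D)%N; split => //.
apply/mem_bigcat_nat; exists (k %/ D * D)%N; split => //.
apply/mem_bigcat_nat; exists i; split => //.
apply/mem_bigcat_nat; exists j; split => //.
apply/mem_bigcat_nat; exists k; split => //.
by rewrite inE.
Qed.

Definition past (e : iteration) : seq location :=
  accesses body [seq f <- iterations N D | before D f e].

(** The cost of an iteration is determined by its triple, so the tiled order of summation can be
    replaced by that of the plain cube. *)
Lemma DMD_TMM_sum (R : realType) :
  DMD_TMM R N D = \sum_(i < N) \sum_(j < N) \sum_(k < N)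
    DMD_after R (past (val i, val j, val k)) (body (val i, val j, val k)).
Proof.
pose F e := DMD_after R (past e) (body e).
pose cube : seq iteration := [seq (ij, k) |
    ij <- [seq (i, j) | i <- index_iota 0 N, j <- index_iota 0 N],
    k <- index_iota 0 N].
rewrite /DMD_TMM tmm_trace_accesses DMD_after_nil -[ [::] ]/(accesses body [::]).
rewrite (DMD_after_accesses body (@before_irr D) (@before_trans D)) /=; last exact: pairwise_before.
rewrite (perm_big cube) /=.
  rewrite big_allpairs big_allpairs big_mkord.
  apply: eq_bigr => i _; rewrite /= big_mkord; apply: eq_bigr => j _.
  by rewrite big_mkord.
apply: uniq_perm.
- apply: (@pairwise_uniq _ (before D)); last exact: pairwise_before.
  exact: before_irr.
- apply: allpairs_uniq; rewrite ?iota_uniq //; last by move=> [? ?] [? ?].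
  by apply: allpairs_uniq; rewrite ?iota_uniq // => -[? ?] [? ?].
move=> [[i j] k]; rewrite mem_iterations; apply/and3P/allpairsP => /=.
  move=> [iN jN kN]; exists ((i, j), k); split=> //=; last by rewrite mem_index_iota.
  by apply/allpairsP; exists (i, j); rewrite !mem_index_iota.
move=> [[ij k'] /= [/allpairsP[[i' j'] /= [+ + ->]] + [-> -> ->]]].
by rewrite !mem_index_iota.
Qed.

Lemma past_window (e0 e : iteration) : e0 \in iterations N D -> before D e0 e ->
  past e = past e0 ++ body e0 ++
    accesses body [seq f <- iterations N D | before D e0 f && before D f e].
Proof.
move=> e0L e0e; rewrite /past.
rewrite (filter_lt_window (@before_irr D) (@before_trans D) pairwise_before e0L e0e).
by rewrite /accesses map_cat flatten_cat.
Qed.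

Lemma mem_accesses (P : pred iteration) (x : location) :
  reflect (exists2 f, f \in iterations N D & P f && (x \in body f))
    (x \in accesses body [seq f <- iterations N D | P f]).
Proof.
apply: (iffP flatten_mapP) => [[f]|[f fL /andP[Pf xf]]]; last first.
  by exists f => //; rewrite mem_filter Pf.
by rewrite mem_filter => /andP[Pf fL] xf; exists f => //; rewrite Pf.
Qed.

(** * Cost bounds from boxes of iterations *)

Definition block_locations (I J K : seq nat) : seq location :=
  [seq elA i k | i <- I, k <- K] ++ [seq elB k j | k <- K, j <- J] ++
  [seq elC i j | i <- I, j <- J].

Lemma body_block (I J K : seq nat) (i j k : nat) : i \in I -> j \in J -> k \in K ->
  {subset body (i, j, k) <= block_locations I J K}.
Proof.
move=> iI jJ kK x; rewrite !inE !mem_cat => /or4P[] /eqP->; apply/or3P.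
- by apply: Or33; apply: allpairs_f.
- by apply: Or31; apply: allpairs_f.
- by apply: Or32; apply: allpairs_f.
- by apply: Or33; apply: allpairs_f.
Qed.

(** All iterations from [e0] to [e] lie in the box I x J x K, whose three faces count the elements
    of A, B and C involved. The list [s] is what [e] has accessed so far. *)
Lemma cost_window_le (R : realType) (e0 e : iteration) (s : seq location)
    (x : location) (I J K : seq nat) :
  e0 \in iterations N D -> e \in iterations N D -> before D e0 e ->
  x \in body e0 -> {subset s <= body e} ->
  (forall i j k, (i, j, k) \in iterations N D ->
     ~~ before D (i, j, k) e0 -> ~~ before D e (i, j, k) ->
     [/\ i \in I, j \in J & k \in K]) ->
  cost R (past e ++ s) x <=
  Num.sqrt (size I * size K + size K * size J + size I * size J)%:R.
Proof.
move=> e0L eL e0e xe0 se IJK.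
have bodyIJK f y : f \in iterations N D -> ~~ before D f e0 -> ~~ before D e f ->
    y \in body f -> y \in block_locations I J K.
  case: f => -[i j] k fL fe0 fe; case: (IJK i j k fL fe0 fe) => iI jJ kK.
  exact: body_block.
have asym f g : before D f g -> ~~ before D g f.
  by move=> fg; apply/negP => /(before_trans fg); rewrite before_irr.
have sz : size (block_locations I J K) =
    (size I * size K + size K * size J + size I * size J)%N.
  by rewrite !size_cat !size_allpairs addnA.
rewrite (past_window e0L e0e) -!catA -sz; apply: cost_le => [_|y].
  by rewrite mem_cat xe0.
rewrite 2!mem_cat => /or3P[].
- by apply: bodyIJK; rewrite ?before_irr // asym.
- case/mem_accesses => f fL /andP[/andP[e0f fe]].
  by apply: bodyIJK; rewrite ?asym.
- by move/se; apply: bodyIJK; rewrite ?before_irr // asym.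
Qed.

(** Here [e0] must be the last earlier iteration using [x], and [s2] is what it accesses afterwards;
    [x] is counted in [U] through its previous access. *)
Lemma cost_window_ge (R : realType) (e0 e : iteration) (s s1 s2 U : seq location)
    (x : location) :
  e0 \in iterations N D -> before D e0 e ->
  body e0 = s1 ++ x :: s2 -> x \notin s2 -> x \notin s ->
  (forall f, f \in iterations N D -> before D e0 f -> before D f e -> x \notin body f) ->
  uniq U -> x \in U ->
  (forall y, y \in U -> y != x ->
     exists2 f, f \in iterations N D & [/\ before D e0 f, before D f e & y \in body f]) ->
  Num.sqrt (size U)%:R <= cost R (past e ++ s) x.
Proof.
move=> e0L e0e e0E xs2 xs xW uU xU UW.
rewrite (past_window e0L e0e) e0E.
set W := accesses _ _.
rewrite (_ : (_ ++ _) ++ s = (past e0 ++ rcons s1 x) ++ (s2 ++ W ++ s)); last first.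
  by rewrite -cats1 /= -!catA.
have -> : size U = (size (rem x U)).+1.
  by rewrite size_rem // prednK //; case: (U) xU.
apply: cost_ge.
- by rewrite mem_cat mem_rcons mem_head orbT.
- rewrite !mem_cat (negbTE xs2) (negbTE xs) orbF /=.
  apply/negP => /mem_accesses[f fL /andP[/andP[e0f fe]]].
  exact/negP/xW.
- exact: rem_uniq.
- move=> y; rewrite mem_rem_uniq // inE => /andP[yx yU].
  have [f fL [e0f fe yf]] := UW y yU yx.
  rewrite !mem_cat; apply/or3P/Or32/mem_accesses.
  by exists f => //; rewrite e0f fe.
Qed.

Definition tiles (q n : nat) : seq nat := iota (q * D) (n * D).

Lemma mem_tiles (q n x : nat) : (x \in tiles q n) = (q <= x %/ D < q + n)%N.
Proof. by rewrite mem_iota -mulnDl leq_divRL // ltn_divLR. Qed.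

Lemma divn_pred (x : nat) : (0 < x)%N ->
  (x %/ D = x.-1 %/ D + (D %| x))%N.
Proof. by case: x => // x _; rewrite /= divnS // addnC. Qed.

(** There are 3 N^2 locations in total, at most (2 N)^2. This crude bound serves the iterations with
    a zero index. *)
Lemma cost_le_all (R : realType) (s : seq location) (x : location) (e : iteration) :
  e \in iterations N D -> {subset s <= body e} ->
  cost R (past e ++ s) x <= (2 * N)%:R.
Proof.
move=> eL se; rewrite -[past e ++ s]/([::] ++ _).
pose c := block_locations (iota 0 N) (iota 0 N) (iota 0 N).
have sub f y : f \in iterations N D -> y \in body f -> y \in c.
  case: f => -[i j] k; rewrite mem_iterations => /and3P[iN jN kN].
  by apply: body_block; rewrite mem_iota.
apply: le_trans (@cost_le R _ _ _ c x _ _) _ => //.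
  move=> y; rewrite mem_cat => /orP[/mem_accesses[f fL /andP[_]]|/se].
    exact: sub.
  exact: sub.
apply: sqrt_nat_le; rewrite /c !size_cat !size_allpairs !size_iota; nia.
Qed.

(** * Costs of the four accesses of one iteration *)

Section Iteration.
Variables (R : realType) (i j k : nat).
Hypotheses (iN : (i < N)%N) (jN : (j < N)%N) (kN : (k < N)%N).
Local Notation e := (i, j, k).

Let eL : e \in iterations N D.
Proof. by rewrite mem_iterations iN jN kN. Qed.

Let D_le_N : (D <= N)%N.
Proof. exact: dvdn_leq (leq_ltn_trans (leq0n _) iN) dvdDN. Qed.

(** The window since [k.-1] fits in all rows, one tile of columns and two tiles of [k]: 2ND + 2D^2 +
    ND <= 5ND locations. *)
Lemma C_read_far_le : (D %| k)%N -> (0 < k)%N ->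
  cost R (past e) (elC i j) <= Num.sqrt (5 * (N * D))%:R.
Proof.
move=> Dk k0; rewrite -[past e]cats0.
have kE := divn_pred k0; rewrite Dk addn1 in kE.
apply: le_trans (@cost_window_le R (i, j, k.-1) _ _ _ (iota 0 N) (tiles (j %/ D) 1)
  (tiles (k.-1 %/ D) 2) _ eL _ _ _ _) _ => //.
- by rewrite mem_iterations iN jN; lia.
- by rewrite /before lexnn lexn_lt //= kE.
- by rewrite inE eqxx.
- move=> i' j' k'; rewrite mem_iterations => /and3P[i'N j'N k'N].
  rewrite /before !negb_lexn /= => ge0 le.
  have [jj {}ge0 {}le] := lexn_squeeze ge0 le.
  move: (lexn_le ge0) (lexn_le le) => {}ge0 {}le.
  by rewrite !mem_tiles jj mem_iota leqnn ge0 addn1 ltnSn addn2 ltnS -kE le.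
by rewrite !size_iota ler_sqrt ?ler0n // ler_nat; nia.
Qed.

(** A 1 x 1 x 2 box has 2 + 2 + 1 = 5 <= 3^2 locations. *)
Lemma C_read_near_le : ~~ (D %| k)%N -> cost R (past e) (elC i j) <= 3%:R.
Proof.
move=> Dk; rewrite -[past e]cats0.
have k0 : (0 < k)%N by case: k Dk => //; rewrite dvdn0.
have kE := divn_pred k0; rewrite (negbTE Dk) addn0 in kE.
apply: le_trans (@cost_window_le R (i, j, k.-1) _ _ _ [:: i] [:: j]
  (iota k.-1 2) _ eL _ _ _ _) _ => //.
- by rewrite mem_iterations iN jN; lia.
- by rewrite /before /= kE !lexnn; lia.
- by rewrite inE eqxx.
- move=> i' j' k'; rewrite mem_iterations => /and3P[i'N j'N k'N].
  rewrite /before !negb_lexn /= => ge0 le.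
  move: le; rewrite kE => le.
  have [_ {}ge0 {}le] := lexn_squeeze ge0 le; have [_ {}ge0 {}le] := lexn_squeeze ge0 le.
  have [-> {}ge0 {}le] := lexn_squeeze ge0 le; have [-> {}ge0 {}le] := lexn_squeeze ge0 le.
  by rewrite !inE !eqxx; split; lia.
exact: sqrt_nat_le.
Qed.

(** The box N x 2D x N gives N^2 + 4ND <= (N + 2D)^2 locations. *)
Lemma A_read_far_le : (D %| j)%N -> (0 < j)%N ->
  cost R (past e ++ [:: elC i j]) (elA i k) <= (N + 2 * D)%:R.
Proof.
move=> Dj j0.
have jE := divn_pred j0; rewrite Dj addn1 in jE.
apply: le_trans (@cost_window_le R (i, j.-1, k) _ _ _ (iota 0 N) (tiles (j.-1 %/ D) 2)
  (iota 0 N) _ eL _ _ _ _) _ => //.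
- by rewrite mem_iterations iN kN; lia.
- by rewrite /before lexn_lt //= jE.
- by rewrite !inE eqxx orbT.
- by move=> y; rewrite !inE => ->.
- move=> i' j' k'; rewrite mem_iterations => /and3P[i'N j'N k'N].
  rewrite /before !negb_lexn /= => ge0 le.
  move: (lexn_le ge0) (lexn_le le) => {}ge0 {}le.
  by rewrite !mem_tiles !mem_iota; split; lia.
by apply: sqrt_nat_le; rewrite !size_iota; nia.
Qed.

(** The box 1 x 2 x D gives D + 2D + 2 <= 5D locations. *)
Lemma A_read_near_le : ~~ (D %| j)%N ->
  cost R (past e ++ [:: elC i j]) (elA i k) <= Num.sqrt (5 * D)%:R.
Proof.
move=> Dj.
have j0 : (0 < j)%N by case: j Dj => //; rewrite dvdn0.
have jE := divn_pred j0; rewrite (negbTE Dj) addn0 in jE.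
apply: le_trans (@cost_window_le R (i, j.-1, k) _ _ _ [:: i] (iota j.-1 2)
  (tiles (k %/ D) 1) _ eL _ _ _ _) _ => //.
- by rewrite mem_iterations iN kN; lia.
- by rewrite /before /= jE !lexnn lexn_lt //; lia.
- by rewrite !inE eqxx orbT.
- by move=> y; rewrite !inE => ->.
- move=> i' j' k'; rewrite mem_iterations => /and3P[i'N j'N k'N].
  rewrite /before !negb_lexn /= => ge0 le.
  move: le; rewrite jE => le.
  have [_ {}ge0 {}le] := lexn_squeeze ge0 le; have [kk {}ge0 {}le] := lexn_squeeze ge0 le.
  have [-> {}ge0 {}le] := lexn_squeeze ge0 le.
  move: (lexn_le ge0) (lexn_le le) => {}ge0 {}le.
  by rewrite !mem_tiles kk !inE eqxx; split; lia.
by rewrite !size_iota ler_sqrt ?ler0n // ler_nat /=; nia.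
Qed.

(** The box 2 x D x D gives D^2 + 4D <= (D + 2)^2 locations. *)
Lemma B_read_le : (0 < i)%N ->
  cost R (past e ++ [:: elC i j; elA i k]) (elB k j) <= (D + 2)%:R.
Proof.
move=> i0.
apply: le_trans (@cost_window_le R (i.-1, j, k) _ _ _ (iota i.-1 2) (tiles (j %/ D) 1)
  (tiles (k %/ D) 1) _ eL _ _ _ _) _ => //.
- by rewrite mem_iterations kN jN; lia.
- by rewrite /before /= !lexnn lexn_lt //; lia.
- by rewrite !inE eqxx !orbT.
- by move=> y; rewrite !inE => /orP[]->; rewrite ?orbT.
- move=> i' j' k'; rewrite mem_iterations => /and3P[i'N j'N k'N].
  rewrite /before !negb_lexn /= => ge0 le.
  have [jj {}ge0 {}le] := lexn_squeeze ge0 le; have [kk {}ge0 {}le] := lexn_squeeze ge0 le.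
  move: (lexn_le ge0) (lexn_le le) => {}ge0 {}le.
  by rewrite !mem_tiles jj kk !inE; split; lia.
by apply: sqrt_nat_le; rewrite !size_iota; nia.
Qed.

Lemma C_write_le : cost R (past e ++ [:: elC i j; elA i k; elB k j]) (elC i j) <= 2%:R.
Proof.
apply: le_trans (cost_le R (c := [:: elC i j; elA i k; elB k j]) _ _) _ => //.
  by rewrite inE eqxx.
exact: sqrt_nat_le.
Qed.

Lemma C_write_ge :
  Num.sqrt 3 <= cost R (past e ++ [:: elC i j; elA i k; elB k j]) (elC i j).
Proof.
rewrite -[[:: elC i j; _; _]]/([:: elC i j] ++ [:: elA i k; elB k j]) catA.
apply: (cost_ge R (u := [:: elA i k; elB k j])) => //.
by rewrite mem_cat mem_head orbT.
Qed.

(** The window always contains the location itself. These units later offset the missing reads of A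
    at j = 0. *)
Lemma C_read_near_ge : ~~ (D %| k)%N -> 1 <= cost R (past e) (elC i j).
Proof.
move=> Dk; rewrite -[past e]cats0 -sqrtr1.
have k0 : (0 < k)%N by case: k Dk => //; rewrite dvdn0.
have kE := divn_pred k0; rewrite (negbTE Dk) addn0 in kE.
apply: (@cost_window_ge R (i, j, k.-1) _ [::] [:: elC i j; elA i k.-1; elB k.-1 j] [::]
  [:: elC i j]) => //.
- by rewrite mem_iterations iN jN; lia.
- by rewrite /before /= kE !lexnn; lia.
- move=> [[i' j'] k'] _; rewrite /before /= => gt0 lt.
  move: lt; rewrite kE => lt.
  have [_ {}gt0 {}lt] := lexn_squeeze gt0 lt; have [_ {}gt0 {}lt] := lexn_squeeze gt0 lt.
  have [_ {}gt0 {}lt] := lexn_squeeze gt0 lt; have [_ {}gt0 {}lt] := lexn_squeeze gt0 lt.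
  by lia.
- by rewrite inE.
- by move=> y; rewrite inE => /eqP->; rewrite eqxx.
Qed.

(** Between columns [j.-1] and [j], in different tiles, every element of A is read: N^2
    locations. *)
Lemma A_read_far_ge : (D %| j)%N -> (0 < j)%N ->
  N%:R <= cost R (past e ++ [:: elC i j]) (elA i k).
Proof.
move=> Dj j0; have jE := divn_pred j0; rewrite Dj addn1 in jE.
have -> : N%:R = Num.sqrt (size [seq elA i' k' | i' <- iota 0 N, k' <- iota 0 N])%:R :> R.
  by rewrite size_allpairs !size_iota mulnn natrX sqrtr_sqr normr_nat.
apply: (@cost_window_ge R (i, j.-1, k) _ _ [:: elC i j.-1]
  [:: elB k j.-1; elC i j.-1]) => //.
- by rewrite mem_iterations iN kN; lia.
- by rewrite /before lexn_lt //= jE.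
- move=> [[i' j'] k'] _; rewrite /before /= => gt0 lt.
  rewrite !inE /= orbF; apply/eqP => -[ii kk].
  move: gt0 lt; rewrite -ii -kk !lexnn !ltnn !lexn_false.
  move=> /lexnP[ge gt0] /lexnP[le lt].
  (* In both cases monotonicity makes the tile quotients coincide, and the comparison inside the
     tile is contradictory. *)
  have [jj'|] := leqP j j'.
    by move: (leq_div2r D jj') le lt => *; lia.
  rewrite -(prednK j0) ltnS => j'j.
  by move: (leq_div2r D j'j) ge gt0 => *; lia.
- by apply: allpairs_uniq; rewrite ?iota_uniq // => -[? ?] [? ?] _ _ [-> ->].
- by apply: allpairs_f; rewrite mem_iota.
move=> y /allpairsP[[i' k'] /= [+ + ->]]; rewrite !mem_iota /= !add0n => i'N k'N ne.
have {}ne : (i, j, k) != (i', j, k').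
  by apply: contra ne => /eqP[-> ->].
(* Elements that come after (i, k) in the order are read in column [j.-1], the others in column
   [j]. *)
have [] := orP (before_total D ne) => [after|prior].
  exists (i', j.-1, k'); first by rewrite mem_iterations i'N k'N; lia.
  split; last by rewrite !inE eqxx orbT.
    by move: after; rewrite /before /= !lexnn.
  by rewrite /before lexn_lt //= jE.
exists (i', j, k'); first by rewrite mem_iterations i'N k'N jN.
split=> //; last by rewrite !inE eqxx orbT.
by rewrite /before lexn_lt //= jE.
Qed.

(** The rest of the current D x D tile of B is read in between: the part after (k, j) in row [i.-1],
    the part before it in row [i]. *)
Lemma B_read_ge : (0 < i)%N ->
  D%:R <= cost R (past e ++ [:: elC i j; elA i k]) (elB k j).
Proof.
move=> i0.
have -> : D%:R = Num.sqrt (size [seq elB k' j' | k' <- tiles (k %/ D) 1,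
    j' <- tiles (j %/ D) 1])%:R :> R.
  by rewrite size_allpairs !size_iota !mul1n mulnn natrX sqrtr_sqr normr_nat.
have tileN x y : (x < N)%N -> (y %/ D = x %/ D)%N -> (y < N)%N.
  by move=> xN xy; move: xN; rewrite -(divnK dvdDN) -!ltn_divLR // xy.
apply: (@cost_window_ge R (i.-1, j, k) _ _ [:: elC i.-1 j; elA i.-1 k]
  [:: elC i.-1 j]) => //.
- by rewrite mem_iterations jN kN; lia.
- by rewrite /before /= !lexnn lexn_lt //; lia.
- move=> [[i' j'] k'] _; rewrite /before /= => gt0 lt.
  rewrite !inE /= orbF; apply/eqP => -[kk jj].
  by move: gt0 lt; rewrite -jj -kk !lexnn !ltnn !lexn_false; lia.
- by apply: allpairs_uniq; rewrite ?iota_uniq // => -[? ?] [? ?] _ _ [-> ->].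
- by apply: allpairs_f; rewrite mem_tiles; lia.
move=> y /allpairsP[[k' j'] /= [+ + ->]]; rewrite !mem_tiles => k'k j'j ne.
have {}ne : (i, j, k) != (i, j', k').
  by apply: contra ne => /eqP[-> ->].
have k'N : (k' < N)%N by apply: (tileN k) => //; lia.
have j'N : (j' < N)%N by apply: (tileN j) => //; lia.
have jj : (j' %/ D = j %/ D)%N by lia.
have kk : (k' %/ D = k %/ D)%N by lia.
have [] := orP (before_total D ne) => [after|prior].
  exists (i.-1, j', k'); first by rewrite mem_iterations j'N k'N; lia.
  split; last by rewrite !inE eqxx !orbT.
    by move: after; rewrite /before /= !lexnn.
  by rewrite /before /= jj kk !lexnn lexn_lt //; lia.
exists (i, j', k'); first by rewrite mem_iterations iN j'N k'N.
split=> //; last by rewrite !inE eqxx !orbT.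
by rewrite /before /= jj kk !lexnn lexn_lt //; lia.
Qed.
End Iteration.

(** * Summation over all iterations *)

Lemma DMD_after_body (R : realType) (p : seq location) (i j k : nat) :
  DMD_after R p (body (i, j, k)) =
  cost R p (elC i j) + cost R (p ++ [:: elC i j]) (elA i k) +
  cost R (p ++ [:: elC i j; elA i k]) (elB k j) +
  cost R (p ++ [:: elC i j; elA i k; elB k j]) (elC i j).
Proof. by rewrite /= -!cats1 -!catA /= addr0 !addrA. Qed.

Lemma sum_dvdn (R : realType) : \sum_(k < N) (D %| k)%:R = (N %/ D)%:R :> R.
Proof.
(* Including the endpoint gives a clean induction; the extra multiple k = N is then removed. *)
suff sumS n : (\sum_(k < n.+1) (D %| k) = (n %/ D).+1)%N.
  rewrite -natr_sum; congr _%:R; apply/eqP.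
  by have := sumS N; rewrite big_ord_recr /= dvdDN addn1 => -[->].
elim: n => [|n IHn]; first by rewrite big_ord_recr big_ord0 dvdn0 div0n.
by rewrite big_ord_recr IHn /= divnS // addnC addnS.
Qed.

Lemma sum_eq0 (R : realType) : (0 < N)%N -> \sum_(k < N) (val k == 0)%:R = 1 :> R.
Proof.
by case: N => // n _; rewrite big_ord_recl /= big1 ?addr0 //.
Qed.

Lemma sum_affine (R : realType) (c b a : R) : (0 < N)%N ->
  \sum_(k < N) (c + (val k == 0)%:R * b + (D %| k)%:R * a) =
  N%:R * c + b + (N %/ D)%:R * a.
Proof.
move=> N0; rewrite 2!big_split /= -!mulr_suml sum_dvdn sum_eq0 // mul1r.
by rewrite sumr_const card_ord -[c *+ N]mulr_natl.
Qed.

(** The common shape of both iteration bounds: a constant, corrections on the faces of the cube, and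
    extra costs at the first [j] or [k] of a tile. *)
Lemma sum_affine3 (R : realType) (c b1 b2 b3 a2 a3 : R) : (0 < N)%N ->
  \sum_(i < N) \sum_(j < N) \sum_(k < N)
    (c + (val i == 0)%:R * b1 + ((val j == 0)%:R * b2 + (D %| j)%:R * a2)
       + ((val k == 0)%:R * b3 + (D %| k)%:R * a3)) =
  N%:R ^+ 3 * c +
  N%:R ^+ 2 * (b1 + b2 + b3 + (N %/ D)%:R * (a2 + a3)).
Proof.
move=> N0; rewrite (eq_bigr (fun i : 'I_N =>
    N%:R ^+ 2 * c + N%:R * (b2 + b3 + (N %/ D)%:R * (a2 + a3)) +
    (val i == 0)%:R * (N%:R ^+ 2 * b1) + (D %| i)%:R * 0)).
  by rewrite sum_affine //; ring.
move=> i _; rewrite (eq_bigr (fun j : 'I_N =>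
    (N%:R * c + N%:R * (val i == 0)%:R * b1 + b3 + (N %/ D)%:R * a3) +
    (val j == 0)%:R * (N%:R * b2) + (D %| j)%:R * (N%:R * a2))).
  by rewrite sum_affine //; ring.
move=> j _; under eq_bigr do rewrite addrA.
by rewrite sum_affine //; ring.
Qed.

(** The constant 7 collects 3 from a near read of C, 2 from the write of C and 2 from the read of
    B. *)
Lemma iteration_cost_le (R : realType) (i j k : nat) :
  (i < N)%N -> (j < N)%N -> (k < N)%N ->
  DMD_after R (past (i, j, k)) (body (i, j, k)) <=
  (D%:R + 7 + Num.sqrt (5 * D)%:R) + (i == 0)%:R * (2 * N)%:R
  + ((j == 0)%:R * (2 * N)%:R + (D %| j)%:R * (N + 2 * D)%:R)
  + ((k == 0)%:R * (2 * N)%:R + (D %| k)%:R * Num.sqrt (5 * (N * D))%:R).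
Proof.
move=> iN jN kN; rewrite DMD_after_body.
have eL : (i, j, k) \in iterations N D by rewrite mem_iterations iN jN kN.
have sA : 0 <= Num.sqrt (5 * D)%:R :> R by exact: sqrtr_ge0.
have sC : 0 <= Num.sqrt (5 * (N * D))%:R :> R by exact: sqrtr_ge0.
have C_read : cost R (past (i, j, k)) (elC i j) <=
    3 + ((k == 0)%:R * (2 * N)%:R + (D %| k)%:R * Num.sqrt (5 * (N * D))%:R).
  have [k0|k0] := posnP k.
    have : cost R (past (i, j, k) ++ [::]) (elC i j) <= (2 * N)%:R by exact: cost_le_all.
    by rewrite cats0 k0 dvdn0 /=; lra.
  rewrite mul0r add0r; have [Dk|Dk] /= := boolP (D %| k)%N.
    by have := C_read_far_le R iN jN kN Dk k0; lra.
  by have := C_read_near_le R iN jN kN Dk; lra.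
have A_read : cost R (past (i, j, k) ++ [:: elC i j]) (elA i k) <=
    Num.sqrt (5 * D)%:R + ((j == 0)%:R * (2 * N)%:R + (D %| j)%:R * (N + 2 * D)%:R).
  have nn : 0 <= (N + 2 * D)%:R :> R by exact: ler0n.
  have [j0|j0] := posnP j.
    have : cost R (past (i, j, k) ++ [:: elC i j]) (elA i k) <= (2 * N)%:R.
      by apply: cost_le_all => // y; rewrite !inE => ->.
    by rewrite j0 dvdn0 /=; lra.
  rewrite mul0r add0r; have [Dj|Dj] /= := boolP (D %| j)%N.
    by have := A_read_far_le R iN jN kN Dj j0; lra.
  by have := A_read_near_le R iN jN kN Dj; lra.
have B_read : cost R (past (i, j, k) ++ [:: elC i j; elA i k]) (elB k j) <=
    (D%:R + 2) + (i == 0)%:R * (2 * N)%:R.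
  have nn : 0 <= D%:R :> R by exact: ler0n.
  have [i0|i0] := posnP i.
    have : cost R (past (i, j, k) ++ [:: elC i j; elA i k]) (elB k j) <= (2 * N)%:R.
      by apply: cost_le_all => // y; rewrite !inE => /orP[]->; rewrite ?orbT.
    by rewrite /=; lra.
  by rewrite mul0r addr0 -natrD; exact: B_read_le.
have := C_write_le R i j k; lra.
Qed.

(** The negative terms cancel the estimates where there may be no earlier access or no useful bound;
    near reads of A are bounded below by 0. *)
Lemma iteration_cost_ge (R : realType) (i j k : nat) :
  (i < N)%N -> (j < N)%N -> (k < N)%N ->
  (D%:R + 1 + Num.sqrt 3) + (i == 0)%:R * - D%:R
  + ((j == 0)%:R * - N%:R + (D %| j)%:R * N%:R)
  + ((k == 0)%:R * 0 + (D %| k)%:R * -1) <=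
  DMD_after R (past (i, j, k)) (body (i, j, k)).
Proof.
move=> iN jN kN; rewrite DMD_after_body.
have cost_ge0 p x : 0 <= cost R p x by rewrite /cost; case: ifP.
have C_read : 1 + (D %| k)%:R * -1 <= cost R (past (i, j, k)) (elC i j).
  have [Dk|Dk] /= := boolP (D %| k)%N; first by rewrite mul1r subrr.
  by rewrite mul0r addr0; exact: C_read_near_ge.
have A_read : (j == 0)%:R * - N%:R + (D %| j)%:R * N%:R <=
    cost R (past (i, j, k) ++ [:: elC i j]) (elA i k).
  have [j0|j0] := posnP j; first by rewrite j0 dvdn0 !mul1r addNr.
  rewrite mul0r add0r; have [Dj|Dj] /= := boolP (D %| j)%N.
    by rewrite mul1r; exact: A_read_far_ge.
  by rewrite mul0r.
have B_read : D%:R + (i == 0)%:R * - D%:R <=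
    cost R (past (i, j, k) ++ [:: elC i j; elA i k]) (elB k j).
  have [i0|i0] := posnP i; first by rewrite mul1r subrr.
  by rewrite mul0r addr0; exact: B_read_ge.
have := C_write_ge R i j k; lra.
Qed.

Lemma DMD_TMM_bounds (R : realType) : (0 < N)%N ->
  N%:R ^+ 3 * ((N %/ D)%:R + D%:R + Num.sqrt 3)
    - N%:R ^+ 2 * ((N %/ D)%:R + D%:R) <= DMD_TMM R N D <=
  N%:R ^+ 3 * ((N %/ D)%:R + D%:R +
    (15 + 3 * (Num.sqrt (N %/ D)%:R + Num.sqrt D%:R))).
Proof.
move=> N0; rewrite DMD_TMM_sum //.
set n : R := N%:R; set d : R := D%:R; set q : R := (N %/ D)%:R.
have nE : n = q * d by rewrite /n /q /d -natrM divnK.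
have sqrt5 : Num.sqrt 5 <= 3 :> R.
  by apply: (@sqrt_nat_le R 5 3).
apply/andP; split.
  apply: le_trans (_ : \sum_(i < N) \sum_(j < N) \sum_(k < N) _ <= _); last first.
    apply: ler_sum => i _; apply: ler_sum => j _; apply: ler_sum => k _.
    exact: (iteration_cost_ge R (ltn_ord i) (ltn_ord j) (ltn_ord k)).
  (* The N^3 from near reads of C exactly offsets the -N^3 from reads of A at j = 0. *)
  by rewrite sum_affine3 // -/n -/d -/q lerBlDr; lra.
apply: le_trans (_ : \sum_(i < N) \sum_(j < N) \sum_(k < N) _ <= _).
  apply: ler_sum => i _; apply: ler_sum => j _; apply: ler_sum => k _.
  exact: (iteration_cost_le R (ltn_ord i) (ltn_ord j) (ltn_ord k)).
have n0 : 0 <= n by exact: ler0n.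
have d0 : 0 <= d by exact: ler0n.
have q0 : 0 <= q by exact: ler0n.
rewrite sum_affine3 // !(natrD, natrM) -/n -/d -/q.
rewrite [Num.sqrt (5 * d)]sqrtrM ?ler0n //.
have -> : Num.sqrt (5 * (n * d)) = d * (Num.sqrt 5 * Num.sqrt q).
  rewrite nE (_ : 5 * (q * d * d) = d ^+ 2 * (5 * q)); last by ring.
  by rewrite sqrtrM ?sqr_ge0 // sqrtr_sqr ger0_norm // sqrtrM ?ler0n.
set s := Num.sqrt q; set t := Num.sqrt d.
have s0 : 0 <= s by exact: sqrtr_ge0.
have t0 : 0 <= t by exact: sqrtr_ge0.
(* With N = qD, the faces give 6 and the term 2qD gives 2; together with 7 this makes the constant
   15. *)
have -> : n ^+ 2 * (2 * n + 2 * n + 2 * n + q * (n + 2 * d + d * (Num.sqrt 5 * s))) =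
    n ^+ 3 * (6 + q + 2 + Num.sqrt 5 * s) by rewrite nE; ring.
rewrite -mulrDr ler_wpM2l ?exprn_ge0 //.
have := ler_wpM2r s0 sqrt5; have := ler_wpM2r t0 sqrt5; lra.
Qed.

End Tiled.

(** * Asymptotics uniform in the tile size *)

Lemma tmm_lowerE (R : realType) (N D : nat) : (0 < D)%N -> (D %| N)%N ->
  tmm_lower R N D = N%:R ^+ 3 * ((N %/ D)%:R + D%:R).
Proof.
move=> D0 DN; rewrite /tmm_lower mulrDr; congr (_ + _).
rewrite exprSr -mulrA; congr (_ * _).
have d0 : D%:R != 0 :> R by rewrite pnatr_eq0 -lt0n.
by rewrite -{1}(divnK DN) natrM mulfK.
Qed.

(** With s = sqrt q and t = sqrt D, the product st = sqrt N forces s + t to be large, while (s +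
    t)^2 <= 2 (q + D). *)
Lemma tmm_error_near (R : realType) (eps : R) : 0 < eps ->
  \forall N \near \oo, forall D : nat, (0 < D)%N -> (D %| N)%N ->
    15 + 3 * (Num.sqrt (N %/ D)%:R + Num.sqrt D%:R) <=
    eps * ((N %/ D)%:R + D%:R).
Proof.
move=> eps0; near=> N => D D0 DN.
have N0 : (0 < N)%N by near: N; exact: nbhs_infty_gt.
(* Since t >= 1, the error is at most 18 (s + t); the factor 2 in the bound on (s + t)^2 doubles
   this to 36. *)
pose M := 36 / eps.
have MN : M ^+ 4 <= N%:R by near: N; exact: nbhs_infty_ger.
set q : R := (N %/ D)%:R; set d : R := D%:R.
set s := Num.sqrt q; set t := Num.sqrt d.
have qE : q = s ^+ 2 by rewrite sqr_sqrtr ?ler0n.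
have dE : d = t ^+ 2 by rewrite sqr_sqrtr ?ler0n.
have nE : N%:R = (s * t) ^+ 2 :> R by rewrite exprMn -qE -dE -natrM divnK.
have s0 : 0 <= s by exact: sqrtr_ge0.
have t1 : 1 <= t by rewrite -sqrtr1 ler_sqrt ?ler0n // ler1n.
have M0 : 0 < M by rewrite divr_gt0.
have MS : M <= s + t.
  rewrite leNgt; apply/negP => SM; move: MN; rewrite nE; apply/negP; rewrite -ltNge.
  have st : s * t < M ^+ 2 by rewrite expr2 ltr_pM //; lra.
  have st0 : 0 <= s * t by rewrite mulr_ge0 //; lra.
  by rewrite -[4%N]/(2 * 2)%N exprM ltr_pXn2r // nnegrE // ltW // exprn_gt0.
have epsS : 36 <= eps * (s + t) by rewrite mulrC -ler_pdivrMr.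
rewrite qE dE; have sq : 0 <= (s - t) ^+ 2 by exact: sqr_ge0.
have : 36 * (s + t) <= eps * (s + t) * (s + t) by rewrite ler_wpM2r //; lra.
have := mulr_ge0 (ltW eps0) sq.
have -> : eps * (s - t) ^+ 2 = 2 * (eps * (s ^+ 2 + t ^+ 2)) - eps * (s + t) * (s + t) by ring.
lra.
Unshelve. all: by end_near. Qed.

Lemma DMD_TMM_upper_near (R : realType) (eps : R) : 0 < eps ->
  \forall N \near \oo, forall D : nat, (0 < D)%N -> (D %| N)%N ->
    N%:R ^+ 3 <= eps * tmm_lower R N D /\
    DMD_TMM R N D <= (1 + eps) * tmm_lower R N D.
Proof.
move=> eps0; near=> N => D D0 DN.
have N0 : (0 < N)%N by near: N; exact: nbhs_infty_gt.
have err : 15 + 3 * (Num.sqrt (N %/ D)%:R + Num.sqrt D%:R) <=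
    eps * ((N %/ D)%:R + D%:R).
  by move: D D0 DN; near: N; exact: tmm_error_near.
have n3 : 0 <= N%:R ^+ 3 :> R by rewrite exprn_ge0 ?ler0n.
have /andP[_ ub] := DMD_TMM_bounds D0 DN R N0.
rewrite tmm_lowerE // !(mulrCA _ (N%:R ^+ 3)); split.
  have := sqrtr_ge0 ((N %/ D)%:R : R); have := sqrtr_ge0 (D%:R : R).
  by move=> d0 q0; rewrite -[leLHS]mulr1 ler_wpM2l //; lra.
by apply: le_trans ub _; rewrite ler_wpM2l //; lra.
Unshelve. all: by end_near. Qed.

(** From (q - 1)(D - 1) >= 0 comes q + D <= N + 1, so the sqrt 3 N^3 from the writes of C outweighs
    the loss N^2 (q + D). *)
Lemma tmm_lower_lt_DMD (R : realType) (N D : nat) :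
  (1 < N)%N -> (0 < D)%N -> (D %| N)%N -> tmm_lower R N D < DMD_TMM R N D.
Proof.
move=> N1 D0 DN; have N0 : (0 < N)%N by exact: ltnW.
have /andP[lb _] := DMD_TMM_bounds D0 DN R N0.
apply: lt_le_trans lb; rewrite tmm_lowerE //.
set n : R := N%:R; set d : R := D%:R; set q : R := (N %/ D)%:R.
have nE : n = q * d by rewrite /n /q /d -natrM divnK.
have d1 : 1 <= d by rewrite ler1n.
have q1 : 1 <= q by rewrite ler1n divn_gt0 // dvdn_leq.
have n2 : 2 <= n by rewrite ler_nat.
have dq : q + d <= n + 1.
  have : 0 <= (q - 1) * (d - 1) by rewrite mulr_ge0 ?subr_ge0.
  by rewrite mulrBl mulrBr -nE; lra.
have n3 : n * (17 / 10) <= n * Num.sqrt 3 by rewrite ler_wpM2l ?sqrt3_ge //; lra.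
have n20 : 0 < n ^+ 2 by rewrite exprn_gt0 //; lra.
have : n ^+ 2 * (q + d) < n ^+ 2 * (n * Num.sqrt 3) by rewrite ltr_pM2l //; lra.
rewrite mulrA -exprSr; lra.
Qed.

(** Leaves room for a relative error of 2/5 and a spare N^4 / D. *)
Lemma tmm_upper_ge (R : realType) (N D : nat) :
  7 / 5 * tmm_lower R N D + N%:R ^+ 4 / D%:R <= tmm_upper R N D.
Proof.
rewrite /tmm_lower /tmm_upper.
have x0 : 0 <= N%:R ^+ 4 / D%:R :> R by rewrite divr_ge0 ?exprn_ge0.
have y0 : 0 <= N%:R ^+ 3 * D%:R :> R by rewrite mulr_ge0 ?exprn_ge0.
have sqrt2 : 7 / 5 <= Num.sqrt 2 :> R.
  rewrite -[7 / 5]ger0_norm -?sqrtr_sqr; last by lra.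
  by rewrite ler_sqrt; lra.
have := ler_wpM2r y0 sqrt2; have := ler_wpM2r x0 (sqrt3_ge R); lra.
Qed.

Theorem theorem3 (R : realType) :
  (exists L : nat -> nat -> R,
     tmm_equiv (@DMD_TMM R) L /\
     forall N D : nat, (0 < N)%N -> (0 < D)%N -> (D %| N)%N ->
       tmm_lower R N D < L N D < tmm_upper R N D) /\
  (\forall N \near \oo, forall D : nat, (0 < D)%N -> (D %| N)%N ->
     tmm_lower R N D < DMD_TMM R N D < tmm_upper R N D).
Proof.
have lower_ge0 N D : 0 <= tmm_lower R N D.
  by rewrite addr_ge0 ?divr_ge0 ?mulr_ge0 ?exprn_ge0.
split; last first.
  near=> N => D D0 DN.
  have N1 : (1 < N)%N by near: N; exact: nbhs_infty_gt.
  rewrite tmm_lower_lt_DMD //=.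
  have [_ ub] : N%:R ^+ 3 <= 5^-1 * tmm_lower R N D /\
      DMD_TMM R N D <= (1 + 5^-1) * tmm_lower R N D.
    by move: D D0 DN; near: N; apply: DMD_TMM_upper_near; rewrite invr_gt0.
  have x0 : 0 < N%:R ^+ 4 / D%:R :> R.
    by rewrite divr_gt0 ?exprn_gt0 ?ltr0n //; exact: ltnW.
  have := lower_ge0 N D; have := tmm_upper_ge R N D; lra.
(* The DMD itself would fail at N = D = 1, where it is sqrt 3 < 2. Adding the negligible N^3 gives
   strictness for every N, and N^3 <= N^4 / D keeps the sum below [tmm_upper]. *)
exists (fun N D => tmm_lower R N D + N%:R ^+ 3); split; last first.
  move=> N D N0 D0 DN; rewrite ltrDl exprn_gt0 ?ltr0n //=.
  apply: lt_le_trans (tmm_upper_ge R N D).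
  have n30 : 0 < N%:R ^+ 3 :> R by rewrite exprn_gt0 ?ltr0n.
  have d1 : 1 <= D%:R :> R by rewrite ler1n.
  have nd : N%:R ^+ 3 <= N%:R ^+ 4 / D%:R :> R.
    rewrite [_ ^+ 4]exprSr -mulrA ler_peMr ?exprn_ge0 //.
    by rewrite ler_pdivlMr ?ltr0n // mul1r ler_nat dvdn_leq.
  have nD : N%:R ^+ 3 <= N%:R ^+ 3 * D%:R :> R by rewrite ler_peMr ?exprn_ge0.
  by rewrite /tmm_lower; lra.
rewrite /tmm_equiv; apply/eqaddoP => eps eps0.
have [M _ NM] := DMD_TMM_upper_near eps0.
have [M1 _ NM1] := nbhs_infty_gt 1.
(* Only [N] is constrained, which expresses uniformity in [D]. *)
exists ([set N | (M <= N)%N /\ (M1 <= N)%N], setT) => /=.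
  split=> //; exists (maxn M M1) => // N /=; rewrite geq_max => /andP[]; by split.
move=> [N D] /= [[MN M1N] _] [N0 [D0 DN]].
have [n3 ub] := NM N MN D D0 DN.
have lb := tmm_lower_lt_DMD R (NM1 N M1N) D0 DN.
have n30 : 0 <= N%:R ^+ 3 :> R by rewrite exprn_ge0.
change (`|DMD_TMM R N D - (tmm_lower R N D + N%:R ^+ 3)| <=
  eps * `|tmm_lower R N D + N%:R ^+ 3|).
(* The difference lies between -N^3 and eps times [tmm_lower], and N^3 is itself at most the
   latter. *)
rewrite [X in eps * X]ger0_norm ?addr_ge0 // ler_norml mulrDr.
have := mulr_ge0 (ltW eps0) n30; have := mulr_ge0 (ltW eps0) (lower_ge0 N D).
by move=> e1 e2; apply/andP; split; lra.
Unshelve. all: by end_near. Qed.
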